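(* Let $n\ge 1$ be an integer, let $D_{2n}=\langle \sigma,\tau \mid \sigma^n=\tau^2=e,\ \tau\sigma\tau=\sigma^{-1}\rangle$ be the dihedral group of order $2n$, and let $X=X(D_{2n},S)$ be its Cayley graph with respect to $S=\{\sigma,\tau\}$. Let $p$ be a prime and let $X_m$ ($m\ge 0$) denote the $m$-th layer of the constant $\mathbb{Z}_p$-tower of $X$. Then the defect satisfies $\delta(X_m)=0$ for all $m\ge 0$.
   Context: A digraph $X$ has a vertex set $V(X)$ and a set $E(X)$ of directed edges (loops and multiple edges allowed), each edge $e$ having an origin $o(e)$ and a terminus $t(e)$. For a group $G$ and a generating set $S$ of $G$, the (directed) Cayley graph $X(G,S)$ has vertex set $G$ and, for every $g\in G$ and $s\in S$, one directed edge from $g$ to $gs$. Constant tower: for a finite digraph $X$ and a prime $p$, let $\Gamma\simeq\mathbb{Z}_p$ (written multiplicatively) have topological generator $\theta$, and let $\theta_m$ be the image of $\theta$ in $\Gamma/\Gamma^{p^m}\simeq\mathbb{Z}/p^m\mathbb{Z}$. The layer $X_m$ of the constant $\mathbb{Z}_p$-tower is the derived digraph of the constant voltage assignment $e\mapsto\theta_m$: its vertex set is $V(X)\times \Gamma/\Gamma^{p^m}$, its edge set is $E(X)\times\Gamma/\Gamma^{p^m}$, and the edge $(e,g)$ goes from $(o(e),g)$ to $(t(e),g\theta_m)$. In particular $X_0=X$. Defect: the adjacency matrix $A_X=[a_{ij}]$ of a finite digraph $X$ has $a_{ij}$ equal to the number of edges from $v_i$ to $v_j$. Let $a(X)$ and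 $b(X)$ be respectively the algebraic and the geometric multiplicity of $1$ as an eigenvalue of $A_X$ (each is $0$ if $1$ is not an eigenvalue). The defect is $\delta(X)=a(X)-b(X)$. *)

(* Defs.v *)
From HB Require Import structures.
From mathcomp Require Import all_boot all_order all_fingroup all_algebra.
From mathcomp Require Import all_solvable all_field.

Set Implicit Arguments.
Unset Strict Implicit.
Unset Printing Implicit Defensive.

Import GRing.Theory.

Record digraph := Digraph {
  vertex : finType;
  edge : finType;
  origin : edge -> vertex;
  terminus : edge -> vertex }.

Definition cayley_digraph (gT : finGroupType) (S : {set gT}) : digraph :=
  @Digraph gT (gT * {s : gT | s \in S})%type
    (fun e => e.1)
    (fun e => (e.1 * val e.2)%g).

Definition derived_digraph (X : digraph) (Q : finGroupType)
    (alpha : edge X -> Q) : digraph :=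
  @Digraph (vertex X * Q)%type (edge X * Q)%type
    (fun e => (origin e.1, e.2))
    (fun e => (terminus e.1, (e.2 * alpha e.1)%g)).

(* Z/p^m, written as 'I_(p ^ m).-1.+1 because 'Z_(p ^ m) would be Z/2 when
   m = 0.  Its canonical finGroupType law is addition modulo p ^ m. *)
Definition Zp_quotient (p m : nat) : finGroupType := 'I_(p ^ m).-1.+1.

(* An element of Z_p, the inverse limit of the Z/p^m, is given by its compatible
   images theta m; it generates Z_p topologically when it generates a dense
   subgroup, that is, when every theta m generates Z/p^m. *)
Definition Zp_topological_generator (p : nat)
    (theta : forall m : nat, Zp_quotient p m) : Prop :=
  (forall m, (theta m.+1 : nat) = (theta m : nat) %[mod p ^ m]) /\
  (forall m, generator [set: Zp_quotient p m] (theta m)).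

Definition constant_layer (X : digraph) (p : nat)
    (theta : forall m : nat, Zp_quotient p m) (m : nat) : digraph :=
  @derived_digraph X (Zp_quotient p m) (fun _ => theta m).

Local Open Scope ring_scope.

(* The matrix has integer entries, so its complex eigenvalues lie in algC. *)
Definition adjacency_mx (X : digraph) : 'M[algC]_#|vertex X| :=
  \matrix_(i, j)
    #|[set e : edge X | (origin e == enum_val i)
                        && (terminus e == enum_val j)]|%:R.

Definition algebraic_mult (n : nat) (A : 'M[algC]_n) (a : algC) : nat :=
  mup a (char_poly A).

(* eigenspace consists of row eigenvectors; its dimension is the same as for
   column eigenvectors. *)
Definition geometric_mult (n : nat) (A : 'M[algC]_n) (a : algC) : nat :=
  \rank (eigenspace A a).

Definition defect (X : digraph) : int :=
  (algebraic_mult (adjacency_mx X) 1)%:Z - (geometric_mult (adjacency_mx X) 1)%:Z.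

(* The group gT is presented by < s, t | s^n = t^2 = 1, tst = s^-1 >, with
   sigma and tau as generators.  Since gT is finite, the last three relations
   and generation make the surjection from the presented group onto gT sending
   s to sigma and t to tau an isomorphism.  The library type 'D_(2 * n) is the
   dihedral group only for n >= 2, whereas this also covers n = 1. *)
Definition dihedral_presentation (n : nat) (gT : finGroupType)
    (sigma tau : gT) : Prop :=
  [/\ ([set: gT] \isog Grp (s : t : s ^+ n, t ^+ 2, t * s * t = s^-1))%g,
      <<[set sigma; tau]>>%g = [set: gT],
      (sigma ^+ n)%g = 1%g,
      (tau ^+ 2)%g = 1%g
    & (tau * sigma * tau)%g = (sigma^-1)%g].

(* Main.v *)
Require Import Defs.
From HB Require Import structures.
From mathcomp Require Import all_boot all_order all_fingroup all_algebra.
From mathcomp Require Import all_solvable all_field.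

Import Order.POrderTheory GRing.Theory Num.Theory.
Local Open Scope ring_scope.
Local Open Scope sesquilinear_scope.

(** Write [s], [t] for the two generators and [z] for the common voltage.  A
    layer of the tower is the Cayley graph of the product of the dihedral group
    by a cyclic group with respect to [s z] and [t z], so its adjacency matrix
    is [B = T(s z) + T(t z)], where [T] is the right regular representation.
    The element [s + s^-1] is central in the group algebra of the dihedral group
    and, because [t s = s^-1 t] and [t^2 = 1],
    [(s + t)^2 = (s + t) (s + s^-1)].  Multiplying by [z^2], with [z] central,
    gives [B^2 = B N] for [N = T(s z) + T(s^-1 z)].

    The matrix [N] is normal, being a sum of two commuting unitary matrices, so
    it has no nontrivial Jordan block.  The relation [B^2 = B N] says that [B]
    acts as [N] on its own image.  The image contains every generalized
    eigenvector of [B] for a nonzero eigenvalue, so nontrivial Jordan blocks of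
    [B] can only occur at the eigenvalue [0] (where they do occur, for instance
    when 4 divides the order of [s]).  In particular [1] is a semisimple
    eigenvalue, and its two multiplicities agree ([semisimple_at_mup]).

    If [s = t] there is a single generator, and the adjacency matrix [T(s z)]
    is itself unitary. *)

(** Sylvester's determinant identity.  Both sides are [y ^+ r] times the
    determinant of the block matrix [(y, L; M, 1)]: clearing [M] by column
    operations gives the left-hand side, clearing it by row operations the
    right-hand side. *)
Lemma det_scalar_sub_mul {R : comNzRingType} {n r} (y : R)
    (L : 'M[R]_(n, r)) (M : 'M[R]_(r, n)) :
  y ^+ r * \det (y%:M - L *m M) = y ^+ n * \det (y%:M - M *m L).
Proof.
set B := block_mx (y%:M : 'M_n) L M (1%:M : 'M_r).
have detL : \det B = \det (y%:M - L *m M).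
  have := det_mulmx B (block_mx 1%:M 0 (- M) 1%:M).
  rewrite det_lblock !det1 !mulr1 => <-.
  rewrite mulmx_block !mulmx0 !mulmx1 !mul1mx addrN !add0r mulmxN.
  by rewrite det_ublock det1 mulr1.
rewrite -detL.
have := det_mulmx (block_mx (1%:M : 'M_n) 0 (- M) (y%:M : 'M_r)) B.
rewrite det_lblock det1 mul1r det_scalar => <-.
rewrite mulmx_block !mul0mx !mulmx1 !mul1mx !addr0.
have -> : - M *m y%:M + y%:M *m M = 0 by rewrite mulNmx scalar_mxC addNr.
by rewrite det_ublock det_scalar mulNmx addrC.
Qed.

(** No generalized eigenvector for [a] has rank two or more, that is, all Jordan
    blocks for [a] have size one; this holds vacuously if [a] is not an
    eigenvalue. *)
Definition semisimple_at {F : fieldType} {n} (A : 'M[F]_n) (a : F) :=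
  forall v : 'rV_n,
    v *m (A - a%:M) *m (A - a%:M) = 0 -> v *m (A - a%:M) = 0.

(** Factor [A - a = L M] through its rank [r].  By Sylvester's identity the
    characteristic polynomial is [('X - a) ^+ (n - r)] times
    [\det (('X - a) - M L)], and semisimplicity says that [M L] is invertible,
    so the second factor does not vanish at [a]. *)
Lemma semisimple_at_mup {F : fieldType} {n} (A : 'M[F]_n) (a : F) :
  semisimple_at A a -> mup a (char_poly A) = \rank (eigenspace A a).
Proof.
rewrite /semisimple_at /eigenspace mxrank_ker.
set C := A - a%:M => ss.
have [L [M [Lfull Mfree LM]]] : exists (L : 'M[F]_(n, \rank C))
    (M : 'M[F]_(\rank C, n)), [/\ row_full L, row_free M & L *m M = C].
  exists (col_base C), (row_base C).
  by rewrite col_base_full row_base_free mulmx_base.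
move: (\rank C) (rank_leq_row C) L M Lfull Mfree LM => r r_le_n L M Lfull Mfree LM.
have ML_unit : M *m L \in unitmx.
  rewrite -row_free_unit -kermx_eq0; apply/rowV0P => w /sub_kermxP.
  have /row_fullP[G GL] := Lfull.
  have -> : w = (w *m G) *m L by rewrite -mulmxA GL mulmx1.
  set v := w *m G; rewrite mulmxA => vLML.
  have /eqP : v *m C = 0 by apply: ss; rewrite -LM !mulmxA vLML mul0mx.
  by rewrite -LM mulmxA mulmx_free_eq0 // => /eqP.
pose y : {poly F} := 'X - a%:P.
have y0 : y != 0 by rewrite polyXsubC_eq0.
have chA : char_poly A = \det (y%:M - map_mx polyC L *m map_mx polyC M).
  rewrite /char_poly /char_poly_mx -map_mxM /= LM /C map_mxB /=.
  by rewrite map_scalar_mx /= /y raddfB /= opprB addrA subrK.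
have yQ : char_poly A =
    y ^+ (n - r) * \det (y%:M - map_mx polyC M *m map_mx polyC L).
  apply: (mulfI (expf_neq0 r y0)).
  by rewrite mulrA -exprD subnKC // chA det_scalar_sub_mul.
rewrite yQ mupMl ?mup_XsubCX ?eqxx //.
have eval_det : (\det (y%:M - map_mx polyC M *m map_mx polyC L)).[a] =
    \det (- (M *m L)).
  rewrite -horner_evalE -det_map_mx; congr (\det _).
  rewrite -map_mxM; apply/matrixP=> i j.
  by rewrite !mxE /= /horner_eval !hornerE hornerMn hornerXsubC subrr mul0rn sub0r.
rewrite /root eval_det -scaleN1r detZ mulf_neq0 ?signr_eq0 // -unitfE.
by rewrite unitmxE in ML_unit.
Qed.


Lemma mul_trmxC_eq0 {C : numClosedFieldType} {n} (u : 'rV[C]_n) :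
  u *m u ^t* = 0 -> u = 0.
Proof.
move=> uu0; apply/eqP; apply: contraTT isT => /dotmx_is_dotmx.
by rewrite dotmxE uu0 mxE ltxx.
Qed.

(** A positivity argument: if [v K K = 0] then, as [K] commutes with its
    adjoint, first [v K K^*] and then [v K] has norm zero. *)
Lemma normalmx_ker_sqr {C : numClosedFieldType} {n} (K : 'M[C]_n)
    (v : 'rV[C]_n) :
  K \is normalmx -> v *m K *m K = 0 -> v *m K = 0.
Proof.
move=> /normalmxP nK vKK.
have conjM m1 m2 m3 (A : 'M[C]_(m1, m2)) (B : 'M[C]_(m2, m3)) :
  (A *m B) ^t* = B ^t* *m A ^t* by rewrite trmx_mul map_mxM.
have vKKs : v *m K *m K ^t* = 0.
  apply: mul_trmxC_eq0; rewrite conjM trmxCK.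
  by rewrite -!mulmxA (mulmxA (K ^t*)) -nK -!mulmxA !mulmxA vKK !mul0mx.
by apply: mul_trmxC_eq0; rewrite conjM mulmxA vKKs mul0mx.
Qed.

Lemma normalmx_subr_scalar {C : numClosedFieldType} {n} (N : 'M[C]_n) (a : C) :
  N \is normalmx -> N - a%:M \is normalmx.
Proof.
move=> /normalmxP nN; apply/normalmxP.
have -> : (N - a%:M) ^t* = N ^t* - (a^*)%:M.
  by rewrite linearB /= tr_scalar_mx map_mxB /= map_scalar_mx.
rewrite !mulmxBl !mulmxBr nN (scalar_mxC a (N ^t*)) (scalar_mxC a).
rewrite -(scalar_mxC a^* N) !opprB !addrA.
by rewrite addrAC [in RHS]addrAC; congr (_ + _); rewrite addrAC.
Qed.

Lemma semisimple_at_normal {n} (N : 'M[algC]_n) (a : algC) :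
  N \is normalmx -> semisimple_at N a.
Proof.
by move=> nN v; apply: normalmx_ker_sqr; apply: normalmx_subr_scalar.
Qed.

(** On the row space of [B] the matrices [B] and [N] act in the same way, and
    the generalized eigenvectors of [B] for [a != 0] lie in that row space.
    Concretely, a Jordan chain [v, w] of [B] for [a] is also one of [N]. *)
Lemma semisimple_at_sqr {F : fieldType} {n} (B N : 'M[F]_n) (a : F) :
  a != 0 -> B *m B = B *m N -> semisimple_at N a -> semisimple_at B a.
Proof.
move=> a0 BB ssN v; set w := v *m (B - _) => wB0.
have vB : v *m B = a *: v + w.
  by rewrite /w mulmxBr mul_mx_scalar addrC subrK.
have wB : w *m B = a *: w.
  by apply/eqP; rewrite -subr_eq0 -mul_mx_scalar -mulmxBr wB0.
have wN : w *m N = a *: w.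
  by apply: (scalerI a0); rewrite scalemxAl -wB -mulmxA -BB mulmxA wB -scalemxAl wB.
have vN : v *m N = a *: v + w.
  apply: (scalerI a0); apply: (addIr (a *: w)).
  rewrite scalemxAl -{1}wN -mulmxDl -vB -mulmxA -BB mulmxA.
  by rewrite vB mulmxDl wB -scalemxAl vB.
have vNa : v *m (N - a%:M) = w by rewrite mulmxBr mul_mx_scalar vN addrC addKr.
by rewrite -vNa; apply: ssN; rewrite vNa mulmxBr mul_mx_scalar wN subrr.
Qed.

(** Right translations: the adjacency matrix of a Cayley graph is a sum of
    these, and on row vectors they multiply in the order of the group law. *)
Definition translation_mx {G : finGroupType} (g : G) : 'M[algC]_#|G| :=
  \matrix_(i, j) (enum_val i * g == enum_val j)%g%:R.

Lemma translation_mxM {G : finGroupType} (g h : G) :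
  translation_mx g *m translation_mx h = translation_mx (g * h)%g.
Proof.
apply/matrixP=> i j; rewrite !mxE (bigD1 (enum_rank (enum_val i * g)%g)) //=.
rewrite !mxE enum_rankK eqxx mul1r mulgA big1 ?addr0 // => k.
by rewrite !mxE -(inj_eq enum_val_inj) enum_rankK eq_sym => /negbTE->; rewrite mul0r.
Qed.

Lemma trmxC_translation_mx {G : finGroupType} (g : G) :
  (translation_mx g) ^t* = translation_mx g^-1%g.
Proof.
apply/matrixP=> i j; rewrite !mxE conjC_nat; congr (nat_of_bool _)%:R.
by apply/eqP/eqP => <-; rewrite ?mulgK ?mulgKV.
Qed.

Lemma normalmx_add_translation_mx {G : finGroupType} (g h : G) :
  commute g h -> translation_mx g + translation_mx h \is normalmx.
Proof.
move=> cgh; apply/normalmxP; rewrite linearD map_mxD /= !trmxC_translation_mx.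
rewrite !mulmxDl !mulmxDr !translation_mxM !mulgV !mulVg.
have -> : (g * h^-1 = h^-1 * g)%g by apply: commuteV.
have -> : (h * g^-1 = g^-1 * h)%g by apply: commuteV.
by rewrite addrACA.
Qed.

Lemma normalmx_translation_mx {G : finGroupType} (g : G) :
  translation_mx g \is normalmx.
Proof.
by apply/normalmxP; rewrite trmxC_translation_mx !translation_mxM mulgV mulVg.
Qed.

(** The identity [B^2 = B N] of the introduction, as an equality between sums of
    four translations. *)
Lemma semisimple_at_dihedral {G : finGroupType} (s t z : G) (a : algC) :
  a != 0 ->
  commute z s -> commute z t -> (t ^+ 2 = 1)%g -> (t * s * t = s^-1)%g ->
  semisimple_at (translation_mx (s * z)%g + translation_mx (t * z)%g) a.
Proof.
move=> a0 zs zt; rewrite expg2 => tt tst.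
have ts : (t * s = s^-1 * t)%g by rewrite -tst -mulgA tt mulg1.
have ts' : (t * s^-1 = s * t)%g.
  by apply: (mulIg s); rewrite mulgKV -mulgA ts mulKVg.
have E x y : commute z y -> (x * z * (y * z) = x * y * z ^+ 2)%g.
  by move=> zy; rewrite mulgA -(mulgA x z) zy !mulgA.
have zs' : commute z s^-1 by apply: commuteV.
apply: (@semisimple_at_sqr _ _ _
          (translation_mx (s * z)%g + translation_mx (s^-1 * z)%g) _ a0).
  rewrite !mulmxDl !mulmxDr !translation_mxM !E // ts ts' mulgV tt.
  by rewrite -!addrA; congr (_ + _); rewrite addrC addrCA addrA.
apply/semisimple_at_normal/normalmx_add_translation_mx.
by rewrite /commute !E // mulgV mulVg.
Qed.

Lemma adjacency_mx_constant_cayley {gT Q : finGroupType} (S : {set gT}) (c : Q) :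
  adjacency_mx (@derived_digraph (cayley_digraph S) Q (fun=> c)) =
  \sum_(s in S) @translation_mx (gT * Q)%type (s, c).
Proof.
apply/matrixP=> i j; rewrite !mxE summxE big_sub.
pose edges_to := [set s : {x | x \in S} | ((enum_val i).1 * val s, (enum_val i).2 * c)%g
                                 == enum_val j :> gT * Q].
pose edge_from (s : {x | x \in S}) := ((enum_val i).1, s, (enum_val i).2).
have -> : [set e : edge (@derived_digraph (cayley_digraph S) Q (fun=> c)) |
              (origin e == enum_val i) && (terminus e == enum_val j)] =
          edge_from @: edges_to.
  apply/setP=> -[[g s] k]; rewrite inE /=; apply/andP/imsetP.
    by case=> /eqP ei ej; exists s; rewrite ?inE /edge_from -ei.
  by case=> s'; rewrite inE => s'j [-> -> ->]; rewrite -surjective_pairing eqxx.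
rewrite card_imset; last by move=> s s' [].
rewrite -sum1_card natr_sum big_mkcond; apply: eq_bigr => s _.
by rewrite mxE inE; case: eqP.
Qed.

Lemma defect_constant_dihedral {gT Q : finGroupType} (s t : gT) (c : Q) :
  (t ^+ 2 = 1)%g -> (t * s * t = s^-1)%g ->
  defect (@derived_digraph (cayley_digraph [set s; t]) Q (fun=> c)) = 0.
Proof.
move=> t2 tst.
suff ss : semisimple_at
    (adjacency_mx (@derived_digraph (cayley_digraph [set s; t]) Q (fun=> c))) 1.
  by rewrite /defect /algebraic_mult (semisimple_at_mup _ _ ss) subrr.
rewrite adjacency_mx_constant_cayley.
have [-> | neq] := eqVneq s t.
  (* The generating set is a singleton, and its translation is unitary. *)
  rewrite setUid big_set1.
  exact/semisimple_at_normal/normalmx_translation_mx.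
rewrite big_setU1 ?inE //= big_set1.
pose G : finGroupType := (gT * Q)%type.
have split_mul g : (g, c) = ((g, 1%g) * (1%g, c))%g :> G.
  by congr (_, _); rewrite ?mulg1 ?mul1g.
rewrite (split_mul s) (split_mul t).
apply: (@semisimple_at_dihedral G); first exact: oner_neq0.
- by rewrite /commute; congr (_, _); rewrite mulg1 mul1g.
- by rewrite /commute; congr (_, _); rewrite mulg1 mul1g.
- rewrite expg2; congr (_, _); last exact: mulg1.
  by rewrite -expg2.
- by congr (_, _); rewrite //= !mulg1 invg1.
Qed.

Theorem theorem3p13 (n : nat) (hn : (1 <= n)%N)
    (gT : finGroupType) (sigma tau : gT)
    (hD : dihedral_presentation n sigma tau)
    (p : nat) (hp : prime p)
    (theta : forall m : nat, Zp_quotient p m)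
    (htheta : Zp_topological_generator theta) (m : nat) :
  defect (constant_layer (cayley_digraph [set sigma; tau]) theta m) = 0%R.
Proof.
by case: hD => _ _ _ tau2 rel; apply: defect_constant_dihedral.
Qed.
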